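(* Let $I$ and $J$ be nonempty sets. An ultrafilter $\mathcal{V}$ on $I\times J$ is a tensor product (i.e. $\mathcal{V}=\mathcal{U}_1\otimes\mathcal{U}_2$ for some ultrafilter $\mathcal{U}_1$ on $I$ and some ultrafilter $\mathcal{U}_2$ on $J$) if and only if $\mathcal{V}\circledast\mathcal{V}=\mathcal{V}$, i.e. $\mathcal{V}$ is idempotent with respect to the operation $\circledast$.
   Context: For ultrafilters $\mathcal{U}_1$ on $I$ and $\mathcal{U}_2$ on $J$, the tensor product $\mathcal{U}_1\otimes\mathcal{U}_2$ is the ultrafilter on $I\times J$ defined by: $X\in\mathcal{U}_1\otimes\mathcal{U}_2$ if and only if $\{i\in I\mid \{j\in J\mid (i,j)\in X\}\in\mathcal{U}_2\}\in\mathcal{U}_1$. On $I\times J$ consider the associative operation $(a,b)\star(c,d)=(a,d)$. Its canonical extension $\circledast$ to the set $\beta(I\times J)$ of ultrafilters on $I\times J$ is defined by setting, for every $X\subseteq I\times J$, $$X\in\mathcal{V}\circledast\mathcal{W}\iff\{(a,b)\in I\times J\mid\{(c,d)\in I\times J\mid (a,b)\star(c,d)\in X\}\in\mathcal{W}\}\in\mathcal{V}.$$ *)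

(* Defs.v *)
From mathcomp Require Import all_boot.
From mathcomp Require Import boolp classical_sets filter.

Set Implicit Arguments.
Unset Strict Implicit.
Unset Printing Implicit Defensive.

Local Open Scope classical_set_scope.

Definition tensor_filter (I J : Type) (U1 : set_system I) (U2 : set_system J) :
    set_system (I * J) :=
  [set X | U1 [set i | U2 [set j | X (i, j)]]].

Definition is_tensor_product (I J : Type) (V : set_system (I * J)) : Prop :=
  exists (U1 : set_system I) (U2 : set_system J),
    [/\ UltraFilter U1, UltraFilter U2 & V = tensor_filter U1 U2].

Definition star (I J : Type) (p q : I * J) : I * J := (p.1, q.2).

(* The canonical extension of a binary operation on [S] to ultrafilters on [S]. *)
Definition beta_ext (S : Type) (op : S -> S -> S) (V W : set_system S) :
    set_system S :=
  [set X | V [set p | W [set q | X (op p q)]]].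

Definition circled_star (I J : Type) (V W : set_system (I * J)) :
    set_system (I * J) :=
  beta_ext (@star I J) V W.

(* Main.v *)
Require Import Defs.
From mathcomp Require Import all_boot.
From mathcomp Require Import boolp classical_sets filter.

(** The point [star p q] only depends on the first coordinate of [p] and the
    second coordinate of [q].  So [circled_star V W] depends on [V] and [W]
    only through their marginals (pushforwards along the two projections): it is
    the tensor product of the first marginal of [V] with the second marginal of
    [W], by mere unfolding ([circled_star_marginals]).

    If [V] is idempotent, this exhibits [V] as the tensor product of its own
    marginals, which are ultrafilters because pushforwards of ultrafilters are
    ([ultra_fmap]).  Conversely, the marginals of a tensor product are its two
    factors ([fst_tensor_filter], [snd_tensor_filter]): a cylinder over [I] or
    over [J] does not depend on the other coordinate, and a proper filter
    contains a constant set exactly when its defining proposition is true.  So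
    the same identity gives back the tensor product. *)

Set Implicit Arguments.
Unset Strict Implicit.
Unset Printing Implicit Defensive.

Local Open Scope classical_set_scope.

(** Maximality is inherited because an ultrafilter decides every preimage: a
    set outside the pushforward has its complement inside it, so no proper
    filter extending the pushforward can contain that set. *)
Lemma ultra_fmap (S T : Type) (f : S -> T) (V : set_system S) :
  UltraFilter V -> UltraFilter (fmap f V).
Proof.
move=> V_ultra; split=> [|G G_proper fVG]; first exact: fmap_proper_filter.
rewrite eqEsubset; split=> // A GA.
have [//|VAc] := in_ultra_setVsetC (f @^-1` A) V_ultra.
have GAc : G (~` A) by exact: fVG.
by case: (filter_not_empty G); rewrite -(setICr A); exact: filterI.
Qed.

Lemma proper_filter_cst (T : Type) (F : set_system T) (P : Prop) :
  ProperFilter F -> F [set _ | P] = P.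
Proof.
move=> F_proper; apply/propext; split; first exact: filter_const.
by move=> hP; exact: filterE.
Qed.

Lemma circled_star_marginals (I J : Type) (V W : set_system (I * J)) :
  circled_star V W = tensor_filter (fmap fst V) (fmap snd W).
Proof. by []. Qed.

Lemma fst_tensor_filter (I J : Type) (U1 : set_system I) (U2 : set_system J) :
  ProperFilter U2 -> fmap fst (tensor_filter U1 U2) = U1.
Proof.
move=> U2_proper; apply/funext => A.
rewrite /fmap /tensor_filter /preimage /=; congr U1.
by apply/funext => i; exact: proper_filter_cst.
Qed.

Lemma snd_tensor_filter (I J : Type) (U1 : set_system I) (U2 : set_system J) :
  ProperFilter U1 -> fmap snd (tensor_filter U1 U2) = U2.
Proof. by move=> U1_proper; apply/funext => B; exact: proper_filter_cst. Qed.

Theorem corollary5p2 (I J : Type) (I_nonempty : inhabited I)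
    (J_nonempty : inhabited J) (V : set_system (I * J)) (V_ultra : UltraFilter V) :
  is_tensor_product V <-> circled_star V V = V.
Proof.
split=> [[U1 [U2 [U1_ultra U2_ultra ->]]]|V_idem].
  by rewrite circled_star_marginals fst_tensor_filter snd_tensor_filter.
exists (fmap fst V), (fmap snd V); split; [exact: ultra_fmap..|].
by rewrite -circled_star_marginals.
Qed.
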